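(* Let $f$ be a continuous univariate concave function defined on $\mathbb{R}_+=[0,\infty)$. The composite function $\theta(t)=f(|t|)$ is dc on $\mathbb{R}$ if and only if the limit $$f'(0;+)=\lim_{\tau\downarrow 0}\frac{f(\tau)-f(0)}{\tau}$$ exists and is finite.
   Context: A function on $\mathbb{R}$ is dc (difference-of-convex) if it is the difference of two real-valued convex functions on $\mathbb{R}$. *)

(* Defs.v *)
From HB Require Import structures.
From mathcomp Require Import all_boot all_order all_algebra.
From mathcomp Require Import all_classical all_reals all_analysis.

Set Implicit Arguments.
Unset Strict Implicit.
Unset Printing Implicit Defensive.

Import Order.TTheory GRing.Theory Num.Theory.
Import numFieldNormedType.Exports.

Local Open Scope classical_set_scope.
Local Open Scope ring_scope.
Local Open Scope convex_scope.

(* As for [convex_function], convexity of the domain [D] is not part of the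
   definition. *)
Definition concave_function (R : numFieldType) (E : lmodType R)
    (E' := convex_lmodType E) (D : set E') (f : E' -> R^o) :=
  forall (t : {i01 R}),
    {in D &, forall (x y : E'), f x <| t |> f y <= f (x <| t |> y)}.

Definition dc_function (R : realType) (h : R -> R) :=
  exists u v : R -> R,
    [/\ convex_function (E := R^o) setT u,
        convex_function (E := R^o) setT v &
        forall x, h x = u x - v x].

(* Main.v *)
(** Put [k(s) = M * s - f(s)].  If all the difference quotients of [f] at [0]
    are at most [M], then [k] is convex and nondecreasing on [0, +oo[, so
    [k(|t|)] is convex and [f(|t|) = M * |t| - k(|t|)] is dc as soon as
    [0 <= M].  Conversely, the difference quotients at [0] of a convex function
    on the whole line are bounded near [0], so those of a dc function are too;
    since those of [f] increase as [tau] decreases to [0], they converge. *)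
Require Import Defs.
From mathcomp Require Import all_boot all_order all_algebra.
From mathcomp Require Import all_classical all_reals all_analysis.
From mathcomp Require Import ring lra.

Set Implicit Arguments.
Unset Strict Implicit.

Import Order.TTheory GRing.Theory Num.Theory.
Import numFieldNormedType.Exports.

Local Open Scope classical_set_scope.
Local Open Scope ring_scope.

Lemma convex_functionP (R : realType) (D : set R) (u : R -> R) :
  convex_function (E := R^o) D u <->
  forall s x y, 0 <= s -> s <= 1 -> D x -> D y ->
    u (s * x + (1 - s) * y) <= s * u x + (1 - s) * u y.
Proof.
split=> [uc s x y s0 s1 Dx Dy | uc t x y /set_mem Dx /set_mem Dy].
  exact: (uc (Itv01 s0 s1) x y (mem_set Dx) (mem_set Dy)).
by apply: uc.
Qed.

Lemma convex_functionN (R : realType) (D : set R) (f : R -> R) :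
  concave_function (E := R^o) D f -> convex_function (E := R^o) D (\- f).
Proof.
move=> fc t x y Dx Dy; rewrite -convN lerN2; exact: fc.
Qed.

(** The point [b] is the convex combination of [a] and [c] with weight [(c - b) / (c - a)] on [a].
    Clearing the denominator keeps the inequality true when [a = c] and leaves it in a form that
    [lra] can use. *)
Lemma convex_three_points (R : realType) (D : set R) (u : R -> R) (a b c : R) :
  convex_function (E := R^o) D u -> D a -> D c -> a <= b -> b <= c ->
  (c - a) * u b <= (c - b) * u a + (b - a) * u c.
Proof.
move=> /convex_functionP uc Da Dc ab bc.
have [ac|] := ltP a c; last first.
  move=> ca; have ab' : a = b by lra.
  have bc' : b = c by lra.
  by rewrite -bc' -ab' !subrr !mul0r addr0.
have ca0 : 0 < c - a by rewrite subr_gt0.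
have s0 : 0 <= (c - b) / (c - a) by rewrite divr_ge0 ?subr_ge0 // ltW.
have s1 : (c - b) / (c - a) <= 1 by rewrite ler_pdivrMr // mul1r lerB.
have nz : c - a != 0 by rewrite gt_eqF.
have := uc _ _ _ s0 s1 Da Dc.
have -> : (c - b) / (c - a) * a + (1 - (c - b) / (c - a)) * c = b by field.
rewrite -(ler_pM2l ca0) => /le_trans; apply.
by rewrite [leLHS](_ : _ = (c - b) * u a + (b - a) * u c) //; field.
Qed.

(** Monotonicity carries the triangle inequality for [s * x + (1 - s) * y] through [k]; convexity of
    [k] at [|x|] and [|y|] does the rest. *)
Lemma convex_comp_normr (R : realType) (k : R -> R) :
  convex_function (E := R^o) `[0, +oo[%classic k ->
  {in `[0, +oo[ &, {homo k : x y / x <= y}} ->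
  convex_function (E := R^o) setT (fun t : R => k `|t|).
Proof.
move=> /convex_functionP kc kmono; apply/convex_functionP => s x y s0 s1 _ _.
have s1' : 0 <= 1 - s by rewrite subr_ge0.
have nn (z : R) : 0 <= z -> `[0, +oo[%classic z by rewrite /= in_itv /= andbT.
apply: (@le_trans _ _ (k (s * `|x| + (1 - s) * `|y|))); last first.
  by apply: kc => //; apply: nn.
apply: kmono; rewrite ?in_itv /= ?andbT ?normr_ge0 //.
  by rewrite addr_ge0 // mulr_ge0.
by rewrite (le_trans (ler_normD _ _)) // !normrM (ger0_norm s0) (ger0_norm s1').
Qed.

(** Slopes of a convex function increase: compare the chord over [[0, tau]] with those over
    [[-1, 0]] and [[0, 1]]. *)
Lemma convex_difference_quotient_bounds (R : realType) (u : R -> R) (tau : R) :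
  convex_function (E := R^o) setT u -> 0 < tau -> tau <= 1 ->
  u 0 - u (-1) <= (u tau - u 0) / tau <= u 1 - u 0.
Proof.
move=> uc t0 t1; rewrite ler_pdivlMr // ler_pdivrMr //.
have := @convex_three_points _ _ _ (-1) 0 tau uc I I ltac:(lra) ltac:(lra).
have := @convex_three_points _ _ _ 0 tau 1 uc I I ltac:(lra) ltac:(lra).
by move=> h1 h2; apply/andP; split; lra.
Qed.

Lemma concave_difference_quotient_nonincreasing (R : realType) (f : R -> R) :
  concave_function (E := R^o) `[0, +oo[%classic f ->
  {in `]0, +oo[ &, {homo (fun tau => (f tau - f 0) / tau) : x y /~ x <= y}}.
Proof.
move=> /convex_functionN fc b a; rewrite !in_itv /= !andbT => b0 a0 ab.
have D0 : `[0, +oo[%classic (0 : R) by rewrite /= in_itv /= lexx.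
have Db : `[0, +oo[%classic b by rewrite /= in_itv /= andbT ltW.
have := convex_three_points fc D0 Db (ltW a0) ab => /= h.
by rewrite ler_pdivrMr // mulrAC ler_pdivlMr //; lra.
Qed.

Lemma dc_comp_normr (R : realType) (f : R -> R) (M : R) :
  concave_function (E := R^o) `[0, +oo[%classic f -> 0 <= M ->
  (forall tau, 0 < tau -> (f tau - f 0) / tau <= M) ->
  dc_function (fun t : R => f `|t|).
Proof.
move=> /convex_functionN fc M0 fM.
have linc (c : R) : 0 <= c ->
    convex_function (E := R^o) `[0, +oo[%classic (fun s => c * s).
  by move=> c0; apply/convex_functionP => s x y _ _ _ _; lra.
pose k s := M * s - f s.
have kc : convex_function (E := R^o) `[0, +oo[%classic k.
  apply/convex_functionP => s x y s0 s1 Dx Dy.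
  move/convex_functionP : fc => /(_ s x y s0 s1 Dx Dy) /=.
  by rewrite /k; lra.
have D0 : `[0, +oo[%classic (0 : R) by rewrite /= in_itv /= lexx.
exists (fun t => M * `|t|), (fun t => k `|t|); split.
- apply: (@convex_comp_normr _ (fun s => M * s)); first exact: linc.
  by move=> x y _ _ xy; exact: ler_wpM2l.
- apply: convex_comp_normr => // a b.
  rewrite !in_itv /= !andbT => a0 b0 ab.
  have [b_gt0|] := ltP 0 b; last first.
    by move=> b_le0; have -> : a = b by lra.
  have Db : `[0, +oo[%classic b by rewrite /= in_itv /= andbT.
  (* The bound [M] on the quotient at [b] says exactly that [k 0 <= k b]. Replacing [k 0] by [k b]
     in [h] gives [b * k a <= b * k b]. *)
  have h := convex_three_points kc D0 Db a0 ab.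
  have k0b : k 0 <= k b.
    by move: (fM b b_gt0); rewrite ler_pdivrMr // /k; lra.
  have h' : (b - a) * k 0 <= (b - a) * k b by rewrite ler_wpM2l // subr_ge0.
  by rewrite -(ler_pM2l b_gt0); lra.
- by move=> t; rewrite /k; lra.
Qed.

Theorem proposition13 (R : realType) (f : R -> R)
    (f_cont : {within `[0, +oo[%classic, continuous f})
    (f_concave : concave_function (E := R^o) `[0, +oo[%classic f) :
  dc_function (fun t : R => f `|t|) <->
  exists l : R, (f tau - f 0) / tau @[tau --> 0^'+] --> l.
Proof.
have q_mono := concave_difference_quotient_nonincreasing f_concave.
split=> [[u [v [uc vc fE]]] | [l ql]].
  (* The limit is the supremum of the quotients over []0, 1]], the range on which the bounds for [u]
     and [v] hold. *)
  eexists; apply: (@nonincreasing_at_right_cvgr _ _ _ (BRight 1)).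
  - by rewrite bnd_simp.
  - move=> x y; rewrite !in_itv /= => /andP[x0 _] /andP[y0 _].
    by apply: q_mono; rewrite in_itv /= andbT.
  - exists (u 1 - u 0 - (v 0 - v (-1))) => _ [tau /= + <-].
    rewrite in_itv /= => /andP[t0 t1].
    have /andP[_ hu] := convex_difference_quotient_bounds uc t0 t1.
    have /andP[hv _] := convex_difference_quotient_bounds vc t0 t1.
    have := fE tau; have := fE 0; rewrite normr0 (gtr0_norm t0) => -> ->.
    have -> : (u tau - v tau - (u 0 - v 0)) / tau =
        (u tau - u 0) / tau - (v tau - v 0) / tau.
      by rewrite -mulrBl; congr (_ / _); ring.
    exact: lerB.
(* The limit [l] may be negative, whereas the bound [M] has to be nonnegative. *)
apply: (@dc_comp_normr _ _ `|l|) => // tau t0.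
apply: (le_trans _ (ler_norm l)).
(* For [s <= tau] the quotient at [s] is at least the one at [tau], so the limit is too. *)
rewrite -(cvg_lim _ ql) //; apply: limr_ge; first by apply/cvg_ex; exists l.
near=> s; apply: q_mono; rewrite ?in_itv /= ?andbT //.
near: s; exact: nbhs_right_le.
Unshelve. all: by end_near. Qed.
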